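(* Consider a relaying system with low-resolution ADCs at the relay (parameter $\alpha$) and at the destinations (parameter $\theta$), and let $R_k$ be the achievable rate of the $k$-th user, given in the context. For sufficiently large $M$, $R_k$ can be accurately approximated by $\tilde R_k$, which is given by $$\tilde R_k=\frac{\tau_c-2\tau_p}{\tau_c}\log_2\left(1+\frac{\tilde A_k}{\tilde B_k+\tilde C_k+\tilde D_k+\tilde E_k+\tilde F_k+\tilde G_k+\tilde H_k}\right)$$ with $$\tilde A_k=p_SM\sigma_{SR,k}^2\sigma_{RD,k}^2,\qquad \tilde B_k=p_S\left(\beta_{SR,k}\sigma_{RD,k}^2+\beta_{RD,k}\sigma_{SR,k}^2\right),$$ $$\tilde C_k=p_S\sum_{j\ne k}\left(\sigma_{RD,k}^2\beta_{SR,j}+\frac{\beta_{RD,k}\sigma_{SR,j}^4\sigma_{RD,j}^2}{\sigma_{SR,k}^2\sigma_{RD,k}^2}\right),\qquad \tilde D_k=p_R\sigma_{LI}^2\sigma_{RD,k}^2,\qquad \tilde E_k=\sigma_{RD,k}^2,$$ $$\tilde F_k=\frac{1-\alpha}{\alpha}\sigma_{RD,k}^2\left(p_S\Big(\sigma_{SR,k}^2+\sum_{i=1}^K\beta_{SR,i}\Big)+p_R\sigma_{LI}^2+1\right),\qquad \tilde G_k=\frac{p_S}{p_R\sigma_{SR,k}^2\sigma_{RD,k}^2}\sum_{i=1}^K\sigma_{SR,i}^4\sigma_{RD,i}^2,$$ $$\begin{aligned}\tilde H_k&=\frac{1-\theta}{\theta}p_S\left(M\sigma_{SR,k}^2\sigma_{RD,k}^2+\frac{\sigma_{SR,k}^2\beta_{RD,k}}{\sigma_{RD,k}^2}\sum_{i=1}^K\sigma_{RD,i}^2\right)+\frac{1-\theta}{\theta}p_S\sigma_{RD,k}^2\left(\sum_{i=1}^K\beta_{SR,i}+\frac{p_R\sigma_{LI}^2+1}{\alpha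 p_S}\right)\\&\quad+\frac{(1-\alpha)(1-\theta)}{\alpha\theta}\sigma_{RD,k}^2p_S\Big(\sigma_{SR,k}^2+\sum_{i=1}^K\beta_{SR,i}\Big)+\frac{(1-\theta)p_S\sum_{i=1}^K\sigma_{SR,i}^4\sigma_{RD,i}^2}{\theta p_R\sigma_{SR,k}^2\sigma_{RD,k}^2}.\end{aligned}$$
   Context: Here $M$ is the number of relay antennas, $K$ the number of user pairs, $k\in\{1,\dots,K\}$; $p_S,p_R,p_p>0$ are the source, relay and pilot powers, $\tau_c>2\tau_p$ the coherence interval and pilot lengths, $\sigma_{LI}^2\ge0$ the residual loop-interference level, $\beta_{SR,i},\beta_{RD,i}>0$ the large-scale fading coefficients, $\alpha,\theta\in(0,1]$ the ADC parameters at relay and destinations ($1$ meaning perfect ADCs), and $\sigma_{SR,i}^2=\frac{\alpha\tau_pp_p\beta_{SR,i}^2}{1+\tau_pp_p\beta_{SR,i}}$, $\sigma_{RD,i}^2=\frac{\alpha\tau_pp_p\beta_{RD,i}^2}{1+\tau_pp_p\beta_{RD,i}}$ for $i=1,\dots,K$ (so $\sigma^4=(\sigma^2)^2$); none of these depends on $M$. The achievable rate is $R_k=\frac{\tau_c-2\tau_p}{\tau_c}\log_2\left(1+\frac{A_k}{B_k+C_k+D_k+E_k+F_k+G_k+H_k}\right)$. Writing $S=\sum_{n=1}^K\sigma_{SR,n}^2\sigma_{RD,n}^2$, $b=\sum_{i=1}^K\beta_{SR,i}$, $L=p_R\sigma_{LI}^2+1$: - $A_k=p_SM^4\sigma_{SR,k}^4\sigma_{RD,k}^4$;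 - $B_k=p_SM^3\sigma_{SR,k}^2\sigma_{RD,k}^2(\beta_{SR,k}\sigma_{RD,k}^2+\beta_{RD,k}\sigma_{SR,k}^2)+p_SM^2\beta_{SR,k}\beta_{RD,k}S$; - $C_k=p_SM^3\sum_{j\ne k}(\sigma_{SR,k}^2\sigma_{RD,k}^4\beta_{SR,j}+\beta_{RD,k}\sigma_{SR,j}^4\sigma_{RD,j}^2)+p_SM^2\sum_{j\ne k}\beta_{SR,j}\beta_{RD,k}S$; - $D_k=M^2\sigma_{LI}^2p_R(M\sigma_{SR,k}^2\sigma_{RD,k}^4+\beta_{RD,k}S)$; - $E_k=M^2(M\sigma_{SR,k}^2\sigma_{RD,k}^4+\beta_{RD,k}S)$; - $F_k=\frac{1-\alpha}{\alpha}\big[M^3p_S\sigma_{SR,k}^2\sigma_{RD,k}^4(\sigma_{SR,k}^2+b)+M^3L\sigma_{SR,k}^2\sigma_{RD,k}^4+M^2L\beta_{RD,k}S+M^2p_S\beta_{RD,k}\sum_{n=1}^K\sigma_{SR,n}^2\sigma_{RD,n}^2(\sigma_{SR,n}^2+b)\big]$; - $G_k=\frac{1}{\alpha^2\gamma^2}$, where $\frac1{\gamma^2}=\frac{M^2}{p_R}\big[p_S(M\alpha^2+\alpha(1-\alpha))\sum_{i=1}^K\sigma_{SR,i}^4\sigma_{RD,i}^2+\alpha S(p_Sb+L)\big]$; - $H_k=\frac{1-\theta}{\theta}p_SM^3\sigma_{SR,k}^2\sigma_{RD,k}^4(M\sigma_{SR,k}^2+b)+\frac{1-\theta}{\theta}p_SM^2\sigma_{SR,k}^2(M\sigma_{SR,k}^2+b)\beta_{RD,k}\sum_{i=1}^K\sigma_{RD,i}^2+\frac{1-\theta}{\alpha\theta}M^2L(M\sigma_{SR,k}^2\sigma_{RD,k}^4+\beta_{RD,k}S)+\frac{(1-\alpha)(1-\theta)}{\alpha\theta}p_S\big[M^3\sigma_{SR,k}^2\sigma_{RD,k}^4(\sigma_{SR,k}^2+b)+M^2\beta_{RD,k}\sum_{n=1}^K\sigma_{SR,n}^4\sigma_{RD,n}^2+M^2\beta_{RD,k}Sb\big]+\frac{1-\theta}{\alpha^2\theta\gamma^2}$.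 The approximation is obtained by ignoring the terms of $A_k,\dots,H_k$ that are insignificant in the large-$M$ regime. *)

(* Defs.v *)
From HB Require Import structures.
From mathcomp Require Import all_boot all_order all_algebra.
From mathcomp Require Import all_classical all_reals all_analysis.

Set Implicit Arguments.
Unset Strict Implicit.
Unset Printing Implicit Defensive.

Import Order.TTheory GRing.Theory Num.Theory.
Import numFieldNormedType.Exports.
Local Open Scope classical_set_scope.
Local Open Scope ring_scope.

Definition log2 (R : realType) (x : R) : R := ln x / ln 2.

(** Data that do not depend on the number [M] of relay antennas. [sLI2] is the
    quantity sigma_LI^2 itself, not sigma_LI. The lengths [tauc] and [taup] are real, which
    covers integer numbers of symbols. *)
Record relay_params (R : realType) (K : nat) := RelayParams {
  pS : R;
  pR : R;
  pp : R;
  tauc : R;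
  taup : R;
  sLI2 : R;
  betaSR : 'I_K -> R;
  betaRD : 'I_K -> R;
  alpha : R;
  theta : R
}.

Section Rates.
Context (R : realType) (K : nat) (P : relay_params R K).

Local Notation pS := (pS P).
Local Notation pR := (pR P).
Local Notation pp := (pp P).
Local Notation tauc := (tauc P).
Local Notation taup := (taup P).
Local Notation sLI2 := (sLI2 P).
Local Notation bSR := (betaSR P).
Local Notation bRD := (betaRD P).
Local Notation a := (alpha P).
Local Notation t := (theta P).

(** sigma_{SR,i}^2 and sigma_{RD,i}^2; hence sigma^4 is [_ ^+ 2] below. *)
Definition sigmaSR2 (i : 'I_K) : R :=
  a * taup * pp * bSR i ^+ 2 / (1 + taup * pp * bSR i).
Definition sigmaRD2 (i : 'I_K) : R :=
  a * taup * pp * bRD i ^+ 2 / (1 + taup * pp * bRD i).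

Local Notation sSR := sigmaSR2.
Local Notation sRD := sigmaRD2.

Definition sumS : R := \sum_(n < K) sSR n * sRD n.
Definition sumb : R := \sum_(i < K) bSR i.
Definition loopL : R := pR * sLI2 + 1.

Local Notation S := sumS.
Local Notation b := sumb.
Local Notation L := loopL.

(** In [termG] and [inv_gamma2], the user index does not occur. *)
Section Exact.
Context (k : 'I_K) (M : nat).
Local Notation m := (M%:R : R).

Definition termA : R := pS * m ^+ 4 * sSR k ^+ 2 * sRD k ^+ 2.

Definition termB : R :=
  pS * m ^+ 3 * sSR k * sRD k * (bSR k * sRD k + bRD k * sSR k)
  + pS * m ^+ 2 * bSR k * bRD k * S.

Definition termC : R :=
  pS * m ^+ 3 * (\sum_(j < K | j != k)
    (sSR k * sRD k ^+ 2 * bSR j + bRD k * sSR j ^+ 2 * sRD j))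
  + pS * m ^+ 2 * (\sum_(j < K | j != k) bSR j * bRD k * S).

Definition termD : R :=
  m ^+ 2 * sLI2 * pR * (m * sSR k * sRD k ^+ 2 + bRD k * S).

Definition termE : R := m ^+ 2 * (m * sSR k * sRD k ^+ 2 + bRD k * S).

Definition termF : R :=
  (1 - a) / a *
  (m ^+ 3 * pS * sSR k * sRD k ^+ 2 * (sSR k + b)
   + m ^+ 3 * L * sSR k * sRD k ^+ 2
   + m ^+ 2 * L * bRD k * S
   + m ^+ 2 * pS * bRD k * (\sum_(n < K) sSR n * sRD n * (sSR n + b))).

(** 1 / gamma^2, the inverse of the squared relay amplification factor. *)
Definition inv_gamma2 : R :=
  m ^+ 2 / pR *
  (pS * (m * a ^+ 2 + a * (1 - a)) * (\sum_(i < K) sSR i ^+ 2 * sRD i)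
   + a * S * (pS * b + L)).

Definition termG : R := 1 / a ^+ 2 * inv_gamma2.

Definition termH : R :=
  (1 - t) / t * pS * m ^+ 3 * sSR k * sRD k ^+ 2 * (m * sSR k + b)
  + (1 - t) / t * pS * m ^+ 2 * sSR k * (m * sSR k + b) * bRD k
    * (\sum_(i < K) sRD i)
  + (1 - t) / (a * t) * m ^+ 2 * L * (m * sSR k * sRD k ^+ 2 + bRD k * S)
  + (1 - a) * (1 - t) / (a * t) * pS *
    (m ^+ 3 * sSR k * sRD k ^+ 2 * (sSR k + b)
     + m ^+ 2 * bRD k * (\sum_(n < K) sSR n ^+ 2 * sRD n)
     + m ^+ 2 * bRD k * S * b)
  + (1 - t) / (a ^+ 2 * t) * inv_gamma2.

Definition rate : R :=
  (tauc - 2 * taup) / tauc *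
  log2 (1 + termA / (termB + termC + termD + termE + termF + termG + termH)).

End Exact.

Section Approx.
Context (k : 'I_K).

Definition tildeA (M : nat) : R := pS * M%:R * sSR k * sRD k.

Definition tildeB : R := pS * (bSR k * sRD k + bRD k * sSR k).

Definition tildeC : R :=
  pS * (\sum_(j < K | j != k)
    (sRD k * bSR j + bRD k * sSR j ^+ 2 * sRD j / (sSR k * sRD k))).

Definition tildeD : R := pR * sLI2 * sRD k.

Definition tildeE : R := sRD k.

Definition tildeF : R :=
  (1 - a) / a * sRD k *
  (pS * (sSR k + \sum_(i < K) bSR i) + pR * sLI2 + 1).

Definition tildeG : R :=
  pS / (pR * sSR k * sRD k) * (\sum_(i < K) sSR i ^+ 2 * sRD i).

Definition tildeH (M : nat) : R :=
  (1 - t) / t * pS *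
    (M%:R * sSR k * sRD k + sSR k * bRD k / sRD k * (\sum_(i < K) sRD i))
  + (1 - t) / t * pS * sRD k *
    ((\sum_(i < K) bSR i) + (pR * sLI2 + 1) / (a * pS))
  + (1 - a) * (1 - t) / (a * t) * sRD k * pS * (sSR k + \sum_(i < K) bSR i)
  + (1 - t) * pS * (\sum_(i < K) sSR i ^+ 2 * sRD i)
    / (t * pR * sSR k * sRD k).

Definition tilde_rate (M : nat) : R :=
  (tauc - 2 * taup) / tauc *
  log2 (1 + tildeA M /
    (tildeB + tildeC + tildeD + tildeE + tildeF + tildeG + tildeH M)).

(** [drops_to X Xt]: after cancelling the factor M^3 sigma_{SR,k}^2
    sigma_{RD,k}^2, which is common to numerator and denominator of the SINR,
    [X] and [Xt] differ only by terms that vanish as M grows. The difference is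
    used rather than the ratio because some terms may be 0 (e.g. D when
    sigma_LI^2 = 0) and because H may contain both M-linear and constant parts,
    which must all be retained. *)
Definition drops_to (X Xt : nat -> R) : Prop :=
  (fun M : nat => X M / (M%:R ^+ 3 * sSR k * sRD k) - Xt M) @ \oo --> (0 : R).

End Approx.
End Rates.

(* Main.v *)
Require Import Defs.
From HB Require Import structures.
From mathcomp Require Import all_boot all_order all_algebra.
From mathcomp Require Import all_classical all_reals all_analysis.
From mathcomp Require Import ring lra.

(** After division by M^3 sigma_{SR,k}^2 sigma_{RD,k}^2 every term of the SINR equals
    its tilde counterpart plus a constant multiple of 1/M.  The simplified denominator
    stays above a positive constant, so the quotient of the two SINRs tends to 1; since
    ln (1 + x) is a 1-Lipschitz function of ln x, the difference of the rates tends to 0.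
    The simplified denominator is affine in M, hence the simplified SINR and the
    simplified rate stay above a positive constant and the quotient of the rates tends
    to 1. *)

Set Implicit Arguments.
Unset Strict Implicit.
Unset Printing Implicit Defensive.

Import Order.TTheory GRing.Theory Num.Theory.
Import numFieldNormedType.Exports.
Local Open Scope classical_set_scope.
Local Open Scope ring_scope.

(** * Limits of real sequences: domination, quotients and logarithms *)

Lemma norm_le_cvg0 (R : realType) (u v : nat -> R) :
  (\forall n \near \oo, `|u n| <= `|v n|) -> v @ \oo --> (0 : R) ->
  u @ \oo --> (0 : R).
Proof.
move=> uv v0; apply: norm_cvg0.
apply: (@squeeze_cvgr _ _ _ _ (fun=> 0) (fun n => `|v n|)).
- by near=> n; rewrite normr_ge0 /=; near: n.
- exact: cvg_cst.
- by rewrite -(normr0 R); apply: cvg_norm.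
Unshelve. all: by end_near. Qed.

(** The deviation of [(1 + q') / (1 + q)] from 1 is that of [q' / q] times [q / (1 + q)], a factor
    in [0, 1] however large or small [q] is; continuity of [ln] at 1 then concludes. Unbounded [q]
    matters because the SINR grows linearly when [theta] is 1. *)
Lemma cvg_ln1D_sub (R : realType) (q q' : nat -> R) :
  (\forall n \near \oo, 0 < q n) ->
  (fun n => q' n / q n) @ \oo --> (1 : R) ->
  (fun n => ln (1 + q' n) - ln (1 + q n)) @ \oo --> (0 : R).
Proof.
move=> q_gt0 q'q.
have xy : (fun n => (1 + q' n) / (1 + q n)) @ \oo --> (1 : R).
  apply/subr_cvg0.
  apply: (@norm_le_cvg0 _ _ (fun n => q' n / q n - 1)); last exact/subr_cvg0.
  near=> n.
  have qn : 0 < q n by near: n.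
  have -> : (1 + q' n) / (1 + q n) - 1 = (q' n / q n - 1) * (q n / (1 + q n)).
    by field; lra.
  rewrite normrM ler_piMr// ger0_norm; last by rewrite divr_ge0//; lra.
  by rewrite ler_pdivrMr; lra.
have lnxy : (fun n => ln ((1 + q' n) / (1 + q n))) @ \oo --> (0 : R).
  rewrite -(@ln1 R).
  exact: (continuous_cvg _ (continuous_ln ltr01) xy).
apply: cvg_trans lnxy; apply: near_eq_cvg.
near=> n.
have qn : 0 < q n by near: n.
(* The sign of [1 + q' n], needed to split the logarithm, is read off the limit: a quotient tending
   to 1 is eventually positive. *)
have xyn : 0 < (1 + q' n) / (1 + q n).
  by near: n; exact: (cvgr_gt _ xy 0 ltr01).
have yn : 0 < 1 + q n by lra.
have xn : 0 < 1 + q' n by move: xyn; rewrite pmulr_lgt0// invr_gt0.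
by rewrite ln_div// posrE.
Unshelve. all: by end_near. Qed.

(** Since [u / v - 1 = (u - v) / v] and [1 / v <= 1 / l], a vanishing absolute error becomes a
    vanishing relative one. It serves twice: for the SINR denominators and for the rates. *)
Lemma cvg_div1 (R : realType) (u v : nat -> R) (l : R) : 0 < l ->
  (\forall n \near \oo, l <= v n) ->
  (fun n => u n - v n) @ \oo --> (0 : R) ->
  (fun n => u n / v n) @ \oo --> (1 : R).
Proof.
move=> l0 lv uv; apply/subr_cvg0.
apply: (@norm_le_cvg0 _ _ (fun n => (u n - v n) * l^-1)); last first.
  by rewrite -(mul0r l^-1); apply: cvgM => //; exact: cvg_cst.
near=> n.
have vn : l <= v n by near: n.
have v0 : 0 < v n by lra.
have -> : u n / v n - 1 = (u n - v n) * (v n)^-1 by field; lra.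
by rewrite !normrM ler_wpM2l// !gtr0_norm ?invr_gt0// lef_pV2 ?posrE.
Unshelve. all: by end_near. Qed.

Ltac nonneg := repeat first
  [done | apply: divr_ge0 | apply: exprn_ge0 | apply: mulr_ge0
  | apply: addr_ge0 | apply: sumr_ge0 => ? _].

(** * Scaled SINR terms and their remainders of order 1/M *)

Section Relay.
Context (R : realType) (K : nat) (P : relay_params R K) (k : 'I_K).

(** Reduces each limit to an exact algebraic identity. Every term is a polynomial in [M] without
    powers below the second; the powers from the third on give [Xt], and [c] is the coefficient of
    the square divided by [sigmaSR2 P k * sigmaRD2 P k]. *)
Lemma drops_to_remainder (X Xt : nat -> R) (c : R) :
  (forall M, (0 < M)%N ->
    X M / (M%:R ^+ 3 * sigmaSR2 P k * sigmaRD2 P k) = Xt M + c / M%:R) ->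
  drops_to P k X Xt.
Proof.
move=> XE; rewrite /drops_to.
have c0 : (fun M : nat => c * (M%:R : R)^-1) @ \oo --> (0 : R).
  rewrite -(mulr0 c); apply: cvgM; first exact: cvg_cst.
  apply/gtr0_cvgV0; last exact: cvgr_idn.
  by near=> n; rewrite ltr0n; near: n; exact: nbhs_infty_gt.
apply: cvg_trans c0; apply: near_eq_cvg.
near=> M.
rewrite XE; first by rewrite addrAC subrr add0r.
by near: M; exact: nbhs_infty_gt.
Unshelve. all: by end_near. Qed.

Lemma drops_toD (X Y Xt Yt : nat -> R) :
  drops_to P k X Xt -> drops_to P k Y Yt ->
  drops_to P k (fun M => X M + Y M) (fun M => Xt M + Yt M).
Proof.
rewrite /drops_to => hX hY.
have := cvgD hX hY; rewrite addr0 => /(_ _) hXY.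
apply: cvg_trans hXY; apply: near_eq_cvg.
by apply: nearW => M /=; rewrite mulrDl opprD addrACA.
Qed.

Hypotheses (pS_gt0 : 0 < pS P) (pR_gt0 : 0 < pR P) (pp_gt0 : 0 < pp P)
  (taup_gt0 : 0 < taup P) (sLI2_ge0 : 0 <= sLI2 P)
  (betaSR_gt0 : forall i : 'I_K, 0 < betaSR P i)
  (betaRD_gt0 : forall i : 'I_K, 0 < betaRD P i)
  (alpha_gt0 : 0 < alpha P) (alpha_le1 : alpha P <= 1)
  (theta_gt0 : 0 < theta P) (theta_le1 : theta P <= 1).

Lemma sigmaSR2_gt0 i : 0 < sigmaSR2 P i.
Proof.
rewrite /sigmaSR2 divr_gt0 ?mulr_gt0 ?exprn_gt0//.
by rewrite addr_gt0 ?mulr_gt0.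
Qed.

Lemma sigmaRD2_gt0 i : 0 < sigmaRD2 P i.
Proof.
rewrite /sigmaRD2 divr_gt0 ?mulr_gt0 ?exprn_gt0//.
by rewrite addr_gt0 ?mulr_gt0.
Qed.

Let sSR_neq0 : sigmaSR2 P k != 0. Proof. exact/lt0r_neq0/sigmaSR2_gt0. Qed.
Let sRD_neq0 : sigmaRD2 P k != 0. Proof. exact/lt0r_neq0/sigmaRD2_gt0. Qed.
Let pS_neq0 : pS P != 0. Proof. exact: lt0r_neq0. Qed.
Let pR_neq0 : pR P != 0. Proof. exact: lt0r_neq0. Qed.
Let alpha_neq0 : alpha P != 0. Proof. exact: lt0r_neq0. Qed.
Let theta_neq0 : theta P != 0. Proof. exact: lt0r_neq0. Qed.

(** The numerator scales without remainder, so comparing the two SINRs reduces to comparing their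
    denominators. *)
Lemma termA_scaled M : (0 < M)%N ->
  termA P k M / (M%:R ^+ 3 * sigmaSR2 P k * sigmaRD2 P k) = tildeA P k M.
Proof.
rewrite -(ltr0n R) => /lt0r_neq0 M0; rewrite /termA /tildeA.
by field; rewrite sSR_neq0 sRD_neq0 M0.
Qed.

Lemma termA_drops : drops_to P k (termA P k) (tildeA P k).
Proof.
by apply: (@drops_to_remainder _ _ 0) => M M0; rewrite termA_scaled// mul0r addr0.
Qed.

Lemma termB_drops : drops_to P k (termB P k) (fun=> tildeB P k).
Proof.
apply: (@drops_to_remainder _ _
  (pS P * betaSR P k * betaRD P k * sumS P / (sigmaSR2 P k * sigmaRD2 P k))) => M.
rewrite -(ltr0n R) => /lt0r_neq0 M0; rewrite /termB /tildeB.
by field; rewrite sSR_neq0 sRD_neq0 M0.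
Qed.

Lemma termC_drops : drops_to P k (termC P k) (fun=> tildeC P k).
Proof.
apply: (@drops_to_remainder _ _
  (pS P * (\sum_(j < K | j != k) betaSR P j * betaRD P k * sumS P)
   / (sigmaSR2 P k * sigmaRD2 P k))) => M.
rewrite -(ltr0n R) => /lt0r_neq0 M0; rewrite /termC /tildeC.
(* Pulling the common denominator out of the sum makes the same sum appear on both sides, after
   which the identity is one of rational functions. *)
have -> : \sum_(j < K | j != k)
    (sigmaRD2 P k * betaSR P j
     + betaRD P k * sigmaSR2 P j ^+ 2 * sigmaRD2 P j / (sigmaSR2 P k * sigmaRD2 P k))
  = (\sum_(j < K | j != k)
      (sigmaSR2 P k * sigmaRD2 P k ^+ 2 * betaSR P j
       + betaRD P k * sigmaSR2 P j ^+ 2 * sigmaRD2 P j)) / (sigmaSR2 P k * sigmaRD2 P k).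
  rewrite mulr_suml; apply: eq_bigr => j _.
  by field; rewrite sSR_neq0 sRD_neq0.
by field; rewrite sSR_neq0 sRD_neq0 M0.
Qed.

Lemma termD_drops : drops_to P k (termD P k) (fun=> tildeD P k).
Proof.
apply: (@drops_to_remainder _ _
  (sLI2 P * pR P * betaRD P k * sumS P / (sigmaSR2 P k * sigmaRD2 P k))) => M.
rewrite -(ltr0n R) => /lt0r_neq0 M0; rewrite /termD /tildeD.
by field; rewrite sSR_neq0 sRD_neq0 M0.
Qed.

Lemma termE_drops : drops_to P k (termE P k) (fun=> tildeE P k).
Proof.
apply: (@drops_to_remainder _ _
  (betaRD P k * sumS P / (sigmaSR2 P k * sigmaRD2 P k))) => M.
rewrite -(ltr0n R) => /lt0r_neq0 M0; rewrite /termE /tildeE.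
by field; rewrite sSR_neq0 sRD_neq0 M0.
Qed.

Lemma termF_drops : drops_to P k (termF P k) (fun=> tildeF P k).
Proof.
apply: (@drops_to_remainder _ _
  ((1 - alpha P) / alpha P * betaRD P k *
   (loopL P * sumS P
    + pS P * (\sum_(n < K) sigmaSR2 P n * sigmaRD2 P n * (sigmaSR2 P n + sumb P)))
   / (sigmaSR2 P k * sigmaRD2 P k))) => M.
rewrite -(ltr0n R) => /lt0r_neq0 M0; rewrite /termF /tildeF -/(sumb P) /loopL.
by field; rewrite sSR_neq0 sRD_neq0 alpha_neq0 M0.
Qed.

Lemma termG_drops : drops_to P k (termG P) (fun=> tildeG P k).
Proof.
apply: (@drops_to_remainder _ _
  (* In [inv_gamma2] only the summand with [m * a ^+ 2] reaches order [M^3]; the summands with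
     [a * (1 - a)] and [a * S] stay at order [M^2] and keep one factor [1 / alpha] after division by
     [a ^+ 2]. *)
  ((pS P * (1 - alpha P) * (\sum_(i < K) sigmaSR2 P i ^+ 2 * sigmaRD2 P i)
    + sumS P * (pS P * sumb P + loopL P))
   / (alpha P * pR P * sigmaSR2 P k * sigmaRD2 P k))) => M.
rewrite -(ltr0n R) => /lt0r_neq0 M0; rewrite /termG /tildeG /inv_gamma2.
by field; rewrite sSR_neq0 sRD_neq0 alpha_neq0 pR_neq0 M0.
Qed.

Lemma termH_drops : drops_to P k (termH P k) (tildeH P k).
Proof.
apply: (@drops_to_remainder _ _
  (* The four summands in the bracket are the [M^2] parts of the second to fifth summands of
     [termH], in that order; the first summand has only powers 3 and 4. *)
  ((1 - theta P) / theta P *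
   (pS P * sigmaSR2 P k * sumb P * betaRD P k * (\sum_(i < K) sigmaRD2 P i)
    + loopL P * betaRD P k * sumS P / alpha P
    + (1 - alpha P) / alpha P * pS P * betaRD P k *
      ((\sum_(n < K) sigmaSR2 P n ^+ 2 * sigmaRD2 P n) + sumS P * sumb P)
    + (pS P * (1 - alpha P) * (\sum_(i < K) sigmaSR2 P i ^+ 2 * sigmaRD2 P i)
       + sumS P * (pS P * sumb P + loopL P)) / (alpha P * pR P))
   / (sigmaSR2 P k * sigmaRD2 P k))) => M.
rewrite -(ltr0n R) => /lt0r_neq0 M0.
rewrite /termH /tildeH /inv_gamma2 -/(sumb P) /loopL.
by field; rewrite sSR_neq0 sRD_neq0 alpha_neq0 theta_neq0 pR_neq0 pS_neq0 M0.
Qed.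

(** * The simplified denominator and the simplified SINR: lower bounds and comparison *)

Definition tilde_slope : R := (1 - theta P) / theta P * pS P * sigmaSR2 P k * sigmaRD2 P k.

Definition tilde_denom (M : nat) : R :=
  tildeB P k + tildeC P k + tildeD P k + tildeE P k + tildeF P k + tildeG P k
  + tildeH P k M.

(** Among the tilde terms of the denominator only [tildeH] involves [M]. The slope vanishes exactly
    when [theta] is 1; otherwise the simplified SINR saturates as [M] grows. *)
Lemma tilde_denom_affine M :
  tilde_denom M = tilde_denom 0 + tilde_slope * M%:R.
Proof. by rewrite /tilde_denom /tildeH /tilde_slope; ring. Qed.

Lemma tilde_slope_ge0 : 0 <= tilde_slope.
Proof.
have t0 : 0 <= (1 - theta P) / theta P by rewrite divr_ge0 ?subr_ge0// ltW.
have pS0 := ltW pS_gt0.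
have sSR0 := ltW (sigmaSR2_gt0 k).
have sRD0 := ltW (sigmaRD2_gt0 k).
by rewrite /tilde_slope; do 3!apply: mulr_ge0 => //.
Qed.

(** Strictness comes from [tildeE], which is [sigmaRD2 P k]; the other terms are nonnegative. *)
Lemma tilde_denom0_gt0 : 0 < tilde_denom 0.
Proof.
have sSR i : 0 <= sigmaSR2 P i by exact/ltW/sigmaSR2_gt0.
have sRD i : 0 <= sigmaRD2 P i by exact/ltW/sigmaRD2_gt0.
have bSR i : 0 <= betaSR P i by exact/ltW.
have bRD i : 0 <= betaRD P i by exact/ltW.
have [pS0 pR0] : 0 <= pS P /\ 0 <= pR P by split; exact/ltW.
have [a0 t0] : 0 <= alpha P /\ 0 <= theta P by split; exact/ltW.
have a1 : 0 <= 1 - alpha P by rewrite subr_ge0.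
have t1 : 0 <= 1 - theta P by rewrite subr_ge0.
have B0 : 0 <= tildeB P k by rewrite /tildeB; nonneg.
have C0 : 0 <= tildeC P k by rewrite /tildeC; nonneg.
have D0 : 0 <= tildeD P k by rewrite /tildeD; nonneg.
have E0 : 0 < tildeE P k by exact: sigmaRD2_gt0.
have sumb0 : 0 <= \sum_(i < K) betaSR P i by rewrite sumr_ge0.
have sumRD0 : 0 <= \sum_(i < K) sigmaRD2 P i by rewrite sumr_ge0.
have sum0 : 0 <= \sum_(i < K) sigmaSR2 P i ^+ 2 * sigmaRD2 P i by nonneg.
have F0 : 0 <= tildeF P k by rewrite /tildeF; nonneg.
have G0 : 0 <= tildeG P k by rewrite /tildeG; nonneg.
have H0 : 0 <= tildeH P k 0 by rewrite /tildeH; nonneg.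
rewrite /tilde_denom; lra.
Qed.

Lemma tilde_denom_ge M : tilde_denom 0 <= tilde_denom M.
Proof. by rewrite (tilde_denom_affine M) lerDl mulr_ge0 ?tilde_slope_ge0. Qed.

Definition tilde_sinr (M : nat) : R := tildeA P k M / tilde_denom M.

Definition denom (M : nat) : R :=
  termB P k M + termC P k M + termD P k M + termE P k M + termF P k M + termG P M
  + termH P k M.

Lemma denom_drops : drops_to P k denom tilde_denom.
Proof.
apply: drops_toD termH_drops; apply: drops_toD termG_drops.
apply: drops_toD termF_drops; apply: drops_toD termE_drops.
by apply: drops_toD termD_drops; apply: drops_toD termC_drops; exact: termB_drops.
Qed.

(** As the scaled numerators are equal, the quotient of the SINRs is the inverse of the quotient of
    the scaled denominator by [tilde_denom], which tends to 1. *)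
Lemma sinr_ratio_cvg :
  (fun M => termA P k M / denom M / tilde_sinr M) @ \oo --> (1 : R).
Proof.
have h := cvg_div1 tilde_denom0_gt0 (nearW eventually_filter tilde_denom_ge) denom_drops.
have {h} := cvgV (oner_neq0 R) h; rewrite invr1 => /(_ _) h.
apply: cvg_trans h; apply: near_eq_cvg; near=> M.
have M0 : (0 < M)%N by near: M; exact: nbhs_infty_gt.
have MR : (M%:R : R) != 0 by rewrite pnatr_eq0 -lt0n.
have A0 : termA P k M != 0.
  by rewrite /termA; repeat first [done | apply: expf_neq0 | apply: mulf_neq0].
(* Here [x] is the numerator, [d] the exact denominator, [s] the scaling factor and [t] the
   simplified denominator. Under the convention that 0 has inverse 0, only [x] has to be nonzero. *)
have quot (x d s t : R) : x != 0 -> (d / s / t)^-1 = x / d / (x / s / t).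
  by move=> x0; rewrite !invfM !invrK !mulrA (mulrAC x) divff// mul1r.
by rewrite /tilde_sinr -termA_scaled// -quot.
Unshelve. all: by end_near. Qed.

(** This is the value of [tilde_sinr] at [M = 1], its minimum over positive [M], because a linear
    function over an affine one with positive constant term is increasing. *)
Definition sinr_floor : R :=
  pS P * sigmaSR2 P k * sigmaRD2 P k / (tilde_denom 0 + tilde_slope).

Lemma sinr_floor_gt0 : 0 < sinr_floor.
Proof.
apply: divr_gt0; last exact: ltr_wpDr tilde_slope_ge0 tilde_denom0_gt0.
by apply: mulr_gt0 (sigmaRD2_gt0 k); apply: mulr_gt0 (sigmaSR2_gt0 k).
Qed.

Lemma tilde_sinr_ge M : (0 < M)%N -> sinr_floor <= tilde_sinr M.
Proof.
move=> M0; have M1 : 1 <= M%:R :> R by rewrite ler1n.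
have d0 := tilde_denom0_gt0; have s0 := tilde_slope_ge0.
rewrite /sinr_floor /tilde_sinr ler_pdivlMr; last first.
  exact/(lt_le_trans d0)/tilde_denom_ge.
rewrite mulrAC ler_pdivrMr; last by lra.
rewrite (tilde_denom_affine M) /tildeA.
have c0 : 0 < pS P * sigmaSR2 P k * sigmaRD2 P k.
  by apply: mulr_gt0 (sigmaRD2_gt0 k); apply: mulr_gt0 (sigmaSR2_gt0 k).
(* After cross-multiplication the slope terms coincide, leaving
   [tilde_denom 0 <= tilde_denom 0 * M]. *)
rewrite [leRHS](_ : _ = pS P * sigmaSR2 P k * sigmaRD2 P k *
  (tilde_denom 0 * M%:R + tilde_slope * M%:R)); last by ring.
by rewrite ler_pM2l// lerD2r ler_peMr// ltW.
Qed.

End Relay.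

(** * From SINRs to rates *)

Theorem proposition1 (R : realType) (K : nat) (P : relay_params R K) (k : 'I_K)
  (pS_gt0 : 0 < pS P) (pR_gt0 : 0 < pR P) (pp_gt0 : 0 < pp P)
  (taup_gt0 : 0 < taup P) (tauc_gt : 2 * taup P < tauc P)
  (sLI2_ge0 : 0 <= sLI2 P)
  (betaSR_gt0 : forall i : 'I_K, 0 < betaSR P i)
  (betaRD_gt0 : forall i : 'I_K, 0 < betaRD P i)
  (alpha_gt0 : 0 < alpha P) (alpha_le1 : alpha P <= 1)
  (theta_gt0 : 0 < theta P) (theta_le1 : theta P <= 1) :
  [/\ (fun M : nat => rate P k M - tilde_rate P k M) @ \oo --> (0 : R),
      (fun M : nat => rate P k M / tilde_rate P k M) @ \oo --> (1 : R) &
      [/\ drops_to P k (termA P k) (tildeA P k),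
          drops_to P k (termB P k) (fun=> tildeB P k),
          drops_to P k (termC P k) (fun=> tildeC P k) &
          drops_to P k (termD P k) (fun=> tildeD P k)] /\
      [/\ drops_to P k (termE P k) (fun=> tildeE P k),
          drops_to P k (termF P k) (fun=> tildeF P k),
          drops_to P k (termG P) (fun=> tildeG P k) &
          drops_to P k (termH P k) (tildeH P k)]].
Proof.
have ln2_gt0 : 0 < ln 2 :> R by rewrite ln_gt0// ltr1n.
(* The pre-log factor and the change of base merge into one positive constant common to both
   rates. *)
set c : R := (tauc P - 2 * taup P) / tauc P / ln 2.
have c_gt0 : 0 < c by rewrite !divr_gt0//; lra.
have rateE M : rate P k M = c * ln (1 + termA P k M / denom P k M).
  by rewrite /rate /log2 /denom /c mulrA mulrAC.
have tilde_rateE M : tilde_rate P k M = c * ln (1 + tilde_sinr P k M).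
  by rewrite /tilde_rate /log2 /tilde_sinr /tilde_denom /c mulrA mulrAC.
have floor_gt0 : 0 < sinr_floor P k by exact: sinr_floor_gt0.
have sinr_ge : \forall M \near \oo, sinr_floor P k <= tilde_sinr P k M.
  by near=> M; apply: tilde_sinr_ge => //; near: M; exact: nbhs_infty_gt.
have rate_sub : (fun M => rate P k M - tilde_rate P k M) @ \oo --> (0 : R).
  rewrite (_ : (fun M => _) = fun M => c *
      (ln (1 + termA P k M / denom P k M) - ln (1 + tilde_sinr P k M))); last first.
    by apply/funext => M; rewrite rateE tilde_rateE mulrBr.
  rewrite -(mulr0 c); apply: cvgM; first exact: cvg_cst.
  apply: cvg_ln1D_sub; last exact: sinr_ratio_cvg.
  by apply: filterS sinr_ge => M; exact: lt_le_trans.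
split=> //.
(* The SINR floor bounds the simplified rate away from 0, so the vanishing difference of the rates
   is also negligible relative to the rate. *)
- apply: (@cvg_div1 _ _ _ (c * ln (1 + sinr_floor P k))) rate_sub.
    by rewrite mulr_gt0// ln_gt0// ltrDl.
  apply: filterS sinr_ge => M le_floor.
  by rewrite tilde_rateE ler_pM2l// ler_ln ?posrE ?lerD2l//; lra.
- split; split.
  + exact: termA_drops.
  + exact: termB_drops.
  + exact: termC_drops.
  + exact: termD_drops.
  + exact: termE_drops.
  + exact: termF_drops.
  + exact: termG_drops.
  + exact: termH_drops.
Unshelve. all: by end_near. Qed.
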